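(* Let $F$ be a field of characteristic different from two, and let $L$ be a nilpotent Lie algebra over $F$ of finite dimension $n$ with $\alpha(L) = n-3$. Then $\beta(L) = n-3$.
   Context: For a finite-dimensional Lie algebra $L$ over a field $F$: $\alpha(L)$ is the maximum of $\dim A$ over abelian subalgebras $A$ of $L$, and $\beta(L)$ is the maximum of $\dim B$ over abelian ideals $B$ of $L$. *)

(* Defs.v *)
From HB Require Import structures.
From mathcomp Require Import all_boot all_order all_algebra.
From mathcomp Require Import boolp.

Set Implicit Arguments.
Unset Strict Implicit.
Unset Printing Implicit Defensive.

Import GRing.Theory.
Local Open Scope ring_scope.

HB.mixin Record Vector_isLie (F : fieldType) L of Vector F L := {
  lie : L -> L -> L;
  lie_linearl : forall y, linear (lie^~ y);
  lie_linearr : forall x, linear (lie x);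
  liexx : forall x, lie x x = 0;
  lie_jacobi : forall x y z,
    lie x (lie y z) + lie y (lie z x) + lie z (lie x y) = 0
}.

#[short(type="lieAlgType")]
HB.structure Definition LieAlgebra (F : fieldType) :=
  {L of Vector F L & Vector_isLie F L}.

Section LieTheory.
Variables (F : fieldType) (L : lieAlgType F).
Implicit Types (U V W A B : {vspace L}) (x y : L).

Definition lie_subalgebra A := forall x y, x \in A -> y \in A -> lie x y \in A.

Definition lie_ideal B := forall x y, x \in B -> lie x y \in B.

Definition lie_abelian A := forall x y, x \in A -> y \in A -> lie x y = 0.

(* The span of all brackets [u, v] with u in U and v in V; as for [prodv] in
   [falgebra], bases suffice, which is the content of [lie_prodv_subP]. *)
Definition lie_prodv U V : {vspace L} :=
  <<[seq lie u v | u <- vbasis U, v <- vbasis V]>>%VS.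

Definition lower_central (k : nat) : {vspace L} :=
  iter k (fun U => lie_prodv U fullv) fullv.

Definition lie_nilpotent := exists k, lower_central k = 0%VS.

Definition max_dim (P : {vspace L} -> Prop) : nat :=
  \max_(m < (\dim {:L}).+1 | `[< exists2 A, P A & \dim A = m >]) m.

Definition lie_alpha : nat :=
  max_dim (fun A => lie_subalgebra A /\ lie_abelian A).

Definition lie_beta : nat :=
  max_dim (fun B => lie_ideal B /\ lie_abelian B).

HB.instance Definition _ x :=
  GRing.isLinear.Build F L L *:%R (lie x) (lie_linearr x).

Lemma lie_suml I (r : seq I) (P : pred I) (E : I -> L) y :
  lie (\sum_(i <- r | P i) E i) y = \sum_(i <- r | P i) lie (E i) y.
Proof.
pose f := GRing.isLinear.Build F L L *:%R (lie^~ y) (lie_linearl y).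
pose g : {linear L -> L} := HB.pack (lie^~ y) f.
exact: (raddf_sum g).
Qed.

Lemma lieZl a x y : lie (a *: x) y = a *: lie x y.
Proof.
pose f := GRing.isLinear.Build F L L *:%R (lie^~ y) (lie_linearl y).
pose g : {linear L -> L} := HB.pack (lie^~ y) f.
exact: (linearZ_LR g).
Qed.

Lemma lie_prodv_subP U V W :
  (lie_prodv U V <= W)%VS <->
  (forall u v, u \in U -> v \in V -> lie u v \in W).
Proof.
split=> [/span_subvP sW u v uU vV | sW]; last first.
  apply/span_subvP=> _ /allpairsP[[u v] /= [uU vV ->]].
  by apply: sW; apply: vbasis_mem.
rewrite (coord_vbasis uU) (coord_vbasis vV) lie_suml memv_suml // => i _.
rewrite lieZl memvZ // linear_sum memv_suml // => j _.
by rewrite linearZ memvZ // sW // allpairs_f // mem_nth // size_tuple.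
Qed.

Lemma max_dim_le (P : {vspace L} -> Prop) A : P A -> (\dim A <= max_dim P)%N.
Proof.
move=> PA; have lt_dim : (\dim A < (\dim {:L}).+1)%N.
  by rewrite ltnS dimvS // subvf.
by apply: (leq_bigmax_cond (Ordinal lt_dim)); apply/asboolP; exists A.
Qed.

Lemma max_dim_attained (P : {vspace L} -> Prop) :
  (exists A, P A) -> exists2 A, P A & \dim A = max_dim P.
Proof.
case=> A PA; have lt_dim : (\dim A < (\dim {:L}).+1)%N.
  by rewrite ltnS dimvS // subvf.
have PA' : `[< exists2 B, P B & \dim B = Ordinal lt_dim >].
  by apply/asboolP; exists A.
rewrite /max_dim (bigmax_eq_arg (Ordinal lt_dim)) //.
by case: arg_maxnP => // i /asboolP.
Qed.

End LieTheory.

Arguments lie_nilpotent {F} L.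
Arguments lie_alpha {F} L.
Arguments lie_beta {F} L.

(* Main.v *)
(* Let A be abelian of dimension n - 3. Proper subalgebras are not self-normalizing,
   so A lies in an ideal M of codimension 1, and the analogous statement for
   codimension 2 lets us take A to be an ideal of M. Write L = M + Fx and D = ad x.
   If an ideal B of L of dimension at least n - 3 has a center of dimension at least
   n - 4, then a refined chain of ideals through that center contains an abelian
   ideal of dimension n - 3: it is contained in the center or has the center as a
   hyperplane. Since A is abelian, the elements c of A with Dc in A centralize DA;
   this either produces such a B or shows that the center Z of M has dimension n - 5
   and that D is nilpotent on the four-dimensional space M / Z, on which the bracket
   induces an alternating form compatible with D. Differentiating the relation
   [A, A] = 0, which costs factors 2, then yields a D-invariant isotropic plane of
   M / Z, whose preimage in M is the required ideal. *)

From HB Require Import structures.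
Require Import Defs.
From mathcomp Require Import all_boot all_order all_algebra.
From mathcomp Require Import boolp zify.

Import GRing.Theory.
Local Open Scope ring_scope.

Set Implicit Arguments.
Unset Strict Implicit.
Unset Printing Implicit Defensive.

Section Brackets.
Variables (F : fieldType) (L : lieAlgType F).
Implicit Types (U V W S T A B C K M N : {vspace L}) (u v w x y z : L).

(** * Bilinearity of the bracket and the adjoint derivation *)

Lemma lieDl x y z : lie (x + y) z = lie x z + lie y z.
Proof.
pose f := GRing.isLinear.Build F L L *:%R (lie^~ z) (lie_linearl z).
pose g : {linear L -> L} := HB.pack (lie^~ z) f.
exact: (raddfD g).
Qed.

Lemma lie0l x : lie 0 x = 0.
Proof. by rewrite -[X in lie X](scale0r 0) lieZl scale0r. Qed.

Lemma lie0r x : lie x 0 = 0.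
Proof. exact: linear0. Qed.

Lemma lieDr x y z : lie x (y + z) = lie x y + lie x z.
Proof. exact: linearD. Qed.

Lemma lieNr x y : lie x (- y) = - lie x y.
Proof. exact: linearN. Qed.

Lemma lieBr x y z : lie x (y - z) = lie x y - lie x z.
Proof. exact: linearB. Qed.

Lemma lieZr a x y : lie x (a *: y) = a *: lie x y.
Proof. exact: linearZ. Qed.

Lemma lieC x y : lie x y = - lie y x.
Proof.
apply/eqP; rewrite -addr_eq0; apply/eqP.
have := liexx (x + y).
by rewrite lieDl !linearD /= !liexx add0r addr0.
Qed.

Lemma lie_der x y z : lie x (lie y z) = lie (lie x y) z + lie y (lie x z).
Proof.
have := lie_jacobi x y z; rewrite -addrA => /eqP; rewrite addr_eq0 => /eqP ->.
rewrite opprD addrC (lieC z (lie x y)) opprK; congr (_ + _).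
by rewrite (lieC z x) linearN opprK.
Qed.

(** * Adjoining a line to a subspace *)

Lemma mem_add_line U v w :
  reflect (exists k, w - k *: v \in U) (w \in U + <[v]>)%VS.
Proof.
apply: (iffP memv_addP) => [[u uU [_ /vlineP[k ->] ->]]|[k wU]].
  by exists k; rewrite addrK.
by exists (w - k *: v) => //; exists (k *: v); rewrite ?memvZ ?memv_line ?subrK.
Qed.

Lemma memv_addl U v w : w \in U -> (w \in U + <[v]>)%VS.
Proof. exact/subvP/addvSl. Qed.

Lemma memv_add_line U v : (v \in U + <[v]>)%VS.
Proof. exact: (subvP (addvSr _ _)) (memv_line v). Qed.

Lemma dim_add_line U v : v \notin U -> \dim (U + <[v]>)%VS = (\dim U).+1.
Proof.
move=> vU; rewrite dimv_disjoint_sum ?dim_vline.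
  by case: eqP vU => [->|_]; rewrite ?mem0v ?addn1.
apply/eqP; rewrite -subv0; apply/subvP=> w; rewrite memv_cap memv0.
case/andP=> wU /vlineP[k def_w]; rewrite def_w; rewrite def_w in wU.
have [->|k0] := eqVneq k 0; first by rewrite scale0r.
by rewrite -(scalerK k0 v) memvZ in vU.
Qed.

Lemma dim_add_line_le U v : (\dim (U + <[v]>)%VS <= (\dim U).+1)%N.
Proof.
by rewrite (leq_trans (dimv_add_leqif _ _)) // dim_vline -addn1 leq_add2l leq_b1.
Qed.

Lemma subv_dim U V : (U <= V)%VS -> (\dim V <= \dim U)%N -> U = V.
Proof. by move=> UV dV; apply/eqP; rewrite eqEdim UV. Qed.

Lemma add_line_sub U v W : (U <= W)%VS -> v \in W -> (U + <[v]> <= W)%VS.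
Proof. by move=> UW vW; rewrite subv_add UW -memvE. Qed.

Lemma add_line_eq U v W : (U <= W)%VS -> v \in W -> v \notin U ->
  (\dim W <= (\dim U).+1)%N -> (U + <[v]>)%VS = W.
Proof.
move=> UW vW vU dW; apply: subv_dim; first exact: add_line_sub.
by rewrite dim_add_line.
Qed.

Lemma dim_nsub U V : (\dim V < \dim U)%N -> ~~ (U <= V)%VS.
Proof. by rewrite ltnNge; apply: contraNN; apply: dimvS. Qed.

(** * Bracket inclusions between subspaces, preimages and centers *)

Definition brk U V T := forall u v, u \in U -> v \in V -> lie u v \in T.

Lemma brkC U V T : brk U V T -> brk V U T.
Proof. by move=> h v u vV uU; rewrite lieC memvN h. Qed.

Lemma brkS U U' V V' T T' : (U' <= U)%VS -> (V' <= V)%VS -> (T <= T')%VS ->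
  brk U V T -> brk U' V' T'.
Proof.
move=> /subvP sU /subvP sV /subvP sT h u v /sU uU /sV vV.
exact: (sT _ (h u v uU vV)).
Qed.

Lemma brkDr U V W T : brk U V T -> brk U W T -> brk U (V + W)%VS T.
Proof.
move=> hV hW u _ uU /memv_addP[v vV [w wW ->]]; rewrite linearD.
exact: memvD (hV _ _ uU vV) (hW _ _ uU wW).
Qed.

Lemma brkDl U V W T : brk U W T -> brk V W T -> brk (U + V)%VS W T.
Proof. by move=> /brkC hU /brkC hV; apply/brkC/brkDr. Qed.

Lemma brk_line U v T : (forall u, u \in U -> lie u v \in T) -> brk U <[v]>%VS T.
Proof. by move=> h u _ uU /vlineP[k ->]; rewrite linearZ memvZ ?h. Qed.

Lemma brk_linel u V T : (forall v, v \in V -> lie u v \in T) -> brk <[u]>%VS V T.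
Proof. by move=> h; apply/brkC/brk_line=> v vV; rewrite lieC memvN h. Qed.

Lemma brk_lines u v T : lie u v \in T -> brk <[u]>%VS <[v]>%VS T.
Proof. by move=> h; apply: brk_line => _ /vlineP[k ->]; rewrite lieZl memvZ. Qed.

Lemma brk_self v : brk <[v]>%VS <[v]>%VS 0%VS.
Proof. by apply: brk_lines; rewrite liexx mem0v. Qed.

Lemma brk0P U V u v : brk U V 0%VS -> u \in U -> v \in V -> lie u v = 0.
Proof. by move=> h uU vV; apply/eqP; rewrite -memv0 h. Qed.

Lemma brk0W U V T : brk U V 0%VS -> brk U V T.
Proof. by apply: brkS; rewrite ?subvv ?sub0v. Qed.

(* Implicit arguments are detected by unfolding [brk], which would also hide the
   vectors of the conclusion. *)
Arguments brkC {U V T} _ u v _ _.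
Arguments brkS {U U' V V' T T'} _ _ _ _ u v _ _.
Arguments brkDr {U V W T} _ _ u v _ _.
Arguments brkDl {U V W T} _ _ u v _ _.
Arguments brk_line {U v T} _ u w _ _ : rename.
Arguments brk_linel {u V T} _ w v _ _ : rename.
Arguments brk_lines {u v T} _ w w' _ _ : rename.
Arguments brk_self v w w' _ _ : rename.
Arguments brk0W {U V T} _ u v _ _.

Definition preim A x B := (A :&: (linfun (lie x) @^-1: B))%VS.

Lemma mem_preim A x B v : (v \in preim A x B) = (v \in A) && (lie x v \in B).
Proof. by rewrite memv_cap -memv_preim lfunE. Qed.

Lemma preim_subl A x B : (preim A x B <= A)%VS.
Proof. exact: capvSl. Qed.

(** A finite intersection of kernels over a basis of [B], hence a subspace by construction. *)
Definition center B :=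
  (B :&: \bigcap_(i < \dim B) lker (linfun (lie (vbasis B)`_i)))%VS.

Lemma center_sub B : (center B <= B)%VS.
Proof. exact: capvSl. Qed.

Lemma mem_center B v :
  v \in center B <-> v \in B /\ (forall b, b \in B -> lie b v = 0).
Proof.
rewrite memv_cap; split=> [/andP[vB /subv_bigcapP h]|[vB h]].
  split=> // b /coord_vbasis ->; rewrite lie_suml big1 // => i _.
  by have := h i isT; rewrite -memvE memv_ker lfunE /= lieZl => /eqP ->;
     rewrite scaler0.
rewrite vB memvE; apply/subv_bigcapP=> i _.
by rewrite -memvE memv_ker lfunE /= h ?vbasis_mem ?mem_nth ?size_tuple.
Qed.

Lemma brk_center B : brk B (center B) 0%VS.
Proof. by move=> b v bB /mem_center[_ ->]; rewrite ?mem0v. Qed.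

Lemma center_max B K : (K <= B)%VS -> brk B K 0%VS -> (K <= center B)%VS.
Proof.
move=> KB h; apply/subvP=> v vK; apply/mem_center; split; first exact: subvP vK.
by move=> b bB; apply: brk0P h bB vK.
Qed.

(** For [b] in [B], Jacobi gives [b, [s, v]] = [[b, s], v] + [s, [b, v]], and both terms vanish. *)
Lemma center_stable S B : brk S B B -> brk S (center B) (center B).
Proof.
move=> hB s v sS /mem_center[vB vC]; apply/mem_center; split=> [|b bB]; first exact: hB.
by rewrite lie_der (vC b) // lie0r addr0 vC // lieC memvN hB.
Qed.

Arguments brk_center B u v _ _ : clear implicits.
Arguments center_stable {S B} _ s v _ _ : rename.

(** * Stable subspaces in a nilpotent algebra *)

(** Let [j] be least such that the [j]-th lower central term meets [B] inside [C]. A vector of [B]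
    outside [C] taken in the preceding term is bracketed into the [j]-th one. *)
Lemma lie_step S B C : lie_nilpotent L -> brk S B B -> ~~ (B <= C)%VS ->
  exists v, [/\ v \in B, v \notin C & forall s, s \in S -> lie s v \in C].
Proof.
case=> k LCk0 hB nBC; pose P j := (B :&: lower_central L j <= C)%VS.
have exP : exists j, P j by exists k; rewrite /P LCk0 capv0 sub0v.
case: (ex_minnP exP) => [[|j]] Pj minj.
  by move: Pj; rewrite /P /lower_central /= capvf (negPf nBC).
have /subvPn[v] : ~~ P j by apply/negP=> /minj; rewrite ltnn.
rewrite memv_cap => /andP[vB vLC] vC; exists v; split=> // s sS.
apply: (subvP Pj); rewrite memv_cap hB //= lieC memvN.
by apply: (lie_prodv_subP _ _ _).1 (subvv _) _ _ vLC (memvf s).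
Qed.

Lemma stable_between S C B d : lie_nilpotent L -> brk S C C -> brk S B B ->
  (C <= B)%VS -> (\dim C <= d)%N -> (d <= \dim B)%N ->
  exists E, [/\ (C <= E)%VS, (E <= B)%VS, brk S E E & \dim E = d].
Proof.
move=> nil hC hB CB /subnK <-; elim: (d - _)%N => [|r IHr] le_d.
  by exists C; rewrite subvv.
have [E [CE EB hE dE]] := IHr (ltnW le_d).
have nBE : ~~ (B <= E)%VS by apply: dim_nsub; rewrite dE.
have [v [vB vE sv]] := lie_step nil hB nBE.
exists (E + <[v]>)%VS; split.
- exact: subv_trans CE (addvSl _ _).
- by rewrite subv_add EB -memvE.
- apply: brkDr; first by apply: brkS hE; rewrite ?subvv ?addvSl.
  by apply: brk_line => s /sv; apply: memv_addl.
- by rewrite dim_add_line // dE.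
Qed.

(* One dimension above a central subspace everything is still abelian. *)
Lemma stable_abelian S B K m : lie_nilpotent L -> brk S B B -> (K <= B)%VS ->
  brk B K 0%VS -> (m <= (\dim K).+1)%N -> (m <= \dim B)%N ->
  exists E, [/\ (E <= B)%VS, brk S E E, brk E E 0%VS & \dim E = m].
Proof.
move=> nil hB KB hK mK mB; have KZ := center_max KB hK.
have ZS := center_stable hB; have ZB := center_sub B.
have h0 : brk S 0%VS 0%VS.
  by move=> s v _; rewrite memv0 => /eqP ->; rewrite lie0r mem0v.
have [le_m|lt_m] := leqP m (\dim (center B)).
  have d0 : (\dim (0%VS : {vspace L}) <= m)%N by rewrite dimv0.
  have [E [_ EZ hE dE]] := stable_between nil h0 ZS (sub0v _) d0 le_m.
  exists E; split=> //; first exact: subv_trans EZ ZB.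
  exact: brkS (subv_trans EZ ZB) EZ (subvv _) (brk_center B).
(* Here [m] is one more than the dimension of the center, so [E] is the center plus a line. *)
have dZ := dimvS KZ.
have [E [ZE EB hE dE]] := stable_between nil ZS hB ZB (ltnW lt_m) mB.
have /subvPn[v vE vZ] : ~~ (E <= center B)%VS.
  by apply: dim_nsub; rewrite dE.
have defE : (center B + <[v]>)%VS = E.
  by apply: add_line_eq => //; rewrite dE (leq_trans mK).
have EZ0 : brk E (center B) 0%VS.
  by apply: brkS (brk_center B); rewrite ?subvv.
have Ev0 : brk E <[v]>%VS 0%VS.
  rewrite -defE; apply: brkDl; last exact: brk_self.
  by apply/brkC; apply: brkS EZ0; rewrite ?subvv -?memvE.
by exists E; split=> //; rewrite -[X in brk _ X]defE; apply: brkDr.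
Qed.

(** A stable chain from [M] down to [Z] has at most [r] steps, and [lie x] descends at least one
    each time. *)
Lemma iter_lie_mem S Z M r x v : lie_nilpotent L -> brk S M M -> brk S Z Z ->
  (Z <= M)%VS -> (\dim M <= \dim Z + r)%N -> x \in S -> v \in M ->
  iter r (lie x) v \in Z.
Proof.
move=> nil hM + + + xS vM; elim: r Z => [|r IHr] Z hZ ZM dM.
  by rewrite /= (subv_dim ZM) // -[\dim Z]addn0.
have [MZ|nMZ] := boolP (M <= Z)%VS.
  apply: (subvP MZ); elim: r.+1 => //= i IHi; exact: hM.
have [w [wM wZ sw]] := lie_step nil hM nMZ.
have hE : brk S (Z + <[w]>)%VS Z by apply: brkDr => //; apply: brk_line.
rewrite iterS; apply: (hE) => //; apply: IHr.
- exact: brkS (addvSl _ _) hE.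
- by rewrite subv_add ZM -memvE.
- by rewrite dim_add_line // addSnnS.
Qed.

(** * Normalizers and abelian ideals of codimension two *)

(** Differentiate [lie a c = 0]; the term [lie a (lie x c)] vanishes because [A] is abelian. *)
Lemma brk_preim A x a c : brk A A 0%VS -> a \in A -> c \in preim A x A ->
  lie (lie x a) c = 0.
Proof.
move=> hA aA; rewrite mem_preim => /andP[cA xcA].
by have := lie_der x a c; rewrite (brk0P hA aA cA) (brk0P hA aA xcA) lie0r addr0.
Qed.

Lemma preim_add_line A x T a : a \in A ->
    (forall c, c \in A -> lie x c \in (T + <[lie x a]>)%VS) ->
  (A <= preim A x T + <[a]>)%VS.
Proof.
move=> aA h; apply/subvP=> c cA; have /mem_add_line[k kT] := h c cA.
apply/mem_add_line; exists k; rewrite mem_preim memvB ?memvZ //=.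
by rewrite linearB linearZ.
Qed.

Lemma subalgebra_step A M : lie_nilpotent L -> brk A A A -> (A <= M)%VS ->
    brk M M M -> (\dim A < \dim M)%N ->
  exists N, [/\ (A <= N)%VS, (N <= M)%VS, brk N N N, brk N A A
              & \dim N = (\dim A).+1].
Proof.
move=> nil hA AM hM dA.
have [||v [vM vA Av]] := @lie_step A M A nil; [exact: brkS hM|exact: dim_nsub|].
have AN : (A <= A + <[v]>)%VS := addvSl _ _.
have hN : brk (A + <[v]>)%VS A A by apply: brkDl => //; apply/brkC/brk_line.
exists (A + <[v]>)%VS; split=> //; [exact: add_line_sub| |exact: dim_add_line].
apply: brkDr; first by apply: brkS hN; rewrite ?subvv.
apply: brkDl; last exact/brk0W/brk_self.
by apply: brk_line => s /Av; apply: memv_addl.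
Qed.

Lemma stable_abelian_codim2 A M : lie_nilpotent L -> brk A A 0%VS -> (A <= M)%VS ->
  brk M M M -> \dim M = (\dim A).+2 ->
  exists E, [/\ (E <= M)%VS, brk M E E, brk E E 0%VS & \dim E = \dim A].
Proof.
move=> nil hA AM hM dM.
have [|N [AN NM hN hNA dN]] := subalgebra_step nil (brk0W hA) AM hM.
  by rewrite dM.
have [|M' [NM' M'M _ hMN dM']] := subalgebra_step nil hN NM hM; first by rewrite dN dM.
(* [N] is a hyperplane of [M], so the strictly larger [M'] normalizing it is all of [M]. *)
have {M' NM' M'M dM'} hMN : brk M N N.
  by rewrite -(subv_dim M'M) // dM' dN dM.
have /subvPn[x xM xN] : ~~ (M <= N)%VS by apply: dim_nsub; rewrite dM dN.
have defM : (N + <[x]>)%VS = M.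
  by apply: add_line_eq => //; rewrite dN dM.
have [xA|/subvPn[a aA]] := boolP (A <= preim A x A)%VS.
  exists A; split=> //; rewrite -defM; apply: brkDl => //.
  by apply: brk_linel => c /(subvP xA); rewrite mem_preim => /andP[].
rewrite mem_preim aA /= => xaA.
have defN : (A + <[lie x a]>)%VS = N.
  by apply: add_line_eq; rewrite ?dN // hMN // (subvP AN).
have AK : (A <= preim A x A + <[a]>)%VS.
  by apply: preim_add_line => // c cA; rewrite defN hMN // (subvP AN).
(* [preim A x A] is central in [N] and has codimension at most one in [A]. *)
have [||||E [EN hE aE dE]] := @stable_abelian M N (preim A x A) (\dim A) nil hMN.
- exact: subv_trans (preim_subl _ _ _) AN.
- rewrite -defN; apply: brkDl; first by apply: brkS hA; rewrite ?subvv ?preim_subl.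
  by apply: brk_linel => c cK; rewrite (brk_preim hA) ?mem0v.
- exact: leq_trans (dimvS AK) (dim_add_line_le _ _).
- by rewrite dN.
by exists E; split=> //; apply: subv_trans EN NM.
Qed.

(** * Isotropic planes stable under a derivation *)

Lemma double_eq0 w : 2%N \notin [pchar F] -> w + w = 0 -> w = 0.
Proof.
rewrite inE /= => two; rewrite -mulr2n -scaler_nat => /eqP.
by rewrite scaler_eq0 (negPf two) => /eqP.
Qed.

Section Derivation.
Variables (x : L) (M K : {vspace L}).
Hypotheses (two : 2%N \notin [pchar F]) (KC : brk M K 0%VS).
Hypothesis xM : forall v, v \in M -> lie x v \in M.
Local Notation D := (lie x).

Lemma lieMK v k : v \in M -> k \in K -> lie v k = 0.
Proof. exact: brk0P. Qed.

Lemma lieKM v k : v \in M -> k \in K -> lie k v = 0.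
Proof. by move=> vM kK; rewrite lieC lieMK ?oppr0. Qed.

(** Differentiate [v0, v1] = 0 repeatedly. At the third stage D[v1, v2] equals both [v1, v3] and its
    opposite, whence 2[v1, v3] = 0. *)
Lemma chain_abelian v0 (v1 := D v0) (v2 := D v1) (v3 := D v2) :
    v0 \in M -> D v3 \in K -> lie v0 v1 = 0 ->
  [/\ lie v0 v2 = 0, lie v1 v2 = - lie v0 v3, lie v1 v3 = 0 & lie v2 v3 = 0].
Proof.
move=> v0M v4K e01.
have [v1M [v2M v3M]] : v1 \in M /\ v2 \in M /\ v3 \in M by rewrite !xM.
have e02 : lie v0 v2 = 0.
  by have := lie_der x v0 v1; rewrite e01 lie0r -/v1 liexx add0r => <-.
have e12 : lie v1 v2 = - lie v0 v3.
  apply/eqP; rewrite -addr_eq0; apply/eqP.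
  by have := lie_der x v0 v2; rewrite e02 lie0r -/v1 -/v3 => <-.
have e13 : lie v1 v3 = 0.
  apply: double_eq0 => //.
  have := lie_der x v1 v2; rewrite e12 lieNr /= lie_der -/v1 -/v2 -/v3 liexx add0r.
  by rewrite (lieMK v0M v4K) addr0 => {1}<-; rewrite addNr.
split=> //; have := lie_der x v1 v3.
by rewrite e13 lie0r -/v2 (lieMK v1M v4K) addr0 => <-.
Qed.

(** Differentiation pushes the relation down the chain, where [v2, v3] is the last bracket to
    survive. *)
Lemma chain_isotropic v0 (v1 := D v0) (v2 := D v1) (v3 := D v2) al be ga :
    v0 \in M -> D v3 \in K -> (al != 0) || (be != 0) ->
    lie v0 (al *: v1 + be *: v2 + ga *: v3) = 0 ->
  lie v2 v3 = 0.
Proof.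
move=> v0M v4K nz R0.
have [v1M [v2M v3M]] : v1 \in M /\ v2 \in M /\ v3 \in M by rewrite !xM.
have d01 : D (lie v0 v1) = lie v0 v2 by rewrite lie_der liexx add0r.
have d02 : D (lie v0 v2) = lie v1 v2 + lie v0 v3 by rewrite lie_der.
have d03 : D (lie v0 v3) = lie v1 v3 by rewrite lie_der (lieMK v0M v4K) addr0.
have d12 : D (lie v1 v2) = lie v1 v3 by rewrite lie_der liexx add0r.
have d13 : D (lie v1 v3) = lie v2 v3 by rewrite lie_der (lieMK v1M v4K) addr0.
have d23 : D (lie v2 v3) = 0 by rewrite lie_der liexx (lieMK v2M v4K) addr0.
rewrite !lieDr !lieZr /= in R0.
(* Differentiate [R0] three times, and once more when [al != 0]. *)
have R3 : al *: (lie v1 v3 + lie v1 v3) + be *: (lie v2 v3 + lie v2 v3) = 0.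
  have := congr1 (fun w => D (D (D w))) R0.
  do ![rewrite ?lieDr ?lieZr /= ?d01 ?d02 ?d03 ?d12 ?d13 ?d23 ?lie0r].
  by rewrite scaler0 addr0.
have [al0|al0] := eqVneq al 0.
  move: R3 nz; rewrite al0 eqxx scale0r add0r => /eqP; rewrite scaler_eq0.
  by case: eqP => //= _ /eqP /double_eq0 ->.
have := congr1 D R3; rewrite !(lieDr, lieZr) /= !d13 !d23 addr0 !scaler0 addr0 lie0r.
move/eqP; rewrite scaler_eq0 (negPf al0) /= => /eqP.
exact: double_eq0.
Qed.

(* Here [K] is the center of [M], the bracket is seen as an alternating form on the
   four-dimensional space [M / K], and [A / K] is an isotropic plane that meets
   its image under [D] trivially. *)
Hypothesis xK : forall k, k \in K -> D k \in K.
Variable A : {vspace L}.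
Hypotheses (hA : brk A A 0%VS) (AM : (A <= M)%VS) (KA : (K <= A)%VS).
Hypothesis AK : forall u, u \in A -> D u \in A -> u \in K.
Hypothesis Mdec : forall v, v \in M -> exists p q, [/\ p \in A, q \in A & v = p + D q].
Hypothesis D4 : forall v, v \in M -> D (D (D (D v))) \in K.
Hypotheses (dA : \dim A = (\dim K).+2) (dM : \dim M = (\dim K).+4).

(** The classes of [e] and [f] are a basis of a [D]-stable plane of [M / K], whose preimage is
    abelian as [K] is central. *)
Definition isotropic_plane e f :=
  [/\ [/\ e \in M, f \in M, e \notin K & f \notin (K + <[e]>)%VS],
      lie e f = 0, D e \in (K + <[e]> + <[f]>)%VS & D f \in (K + <[e]> + <[f]>)%VS].

Let in_K2 e f w : w \in K -> w \in (K + <[e]> + <[f]>)%VS.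
Proof. by move=> wK; rewrite !memv_addl. Qed.

(** The plane is the image of [A] under [D]: it has dimension two modulo [K] by [AK], and the second
    derivative of [a, b] = 0 reduces to 2[Da, Db] = 0. *)
Lemma plane_of_square_zero : (forall a, a \in A -> D (D a) \in K) ->
  exists e f, isotropic_plane e f.
Proof.
move=> D2.
have /subvPn[a aA aK] : ~~ (A <= K)%VS by apply: dim_nsub; rewrite dA.
have /subvPn[b bA bK] : ~~ (A <= K + <[a]>)%VS.
  by apply: dim_nsub; rewrite dA dim_add_line.
have [aM bM] : a \in M /\ b \in M by rewrite !(subvP AM).
exists (D a), (D b); split; last 2 first.
- by rewrite in_K2 ?D2.
- by rewrite in_K2 ?D2.
- split; rewrite ?xM //.
    by apply: contraNN aK => xaK; exact: AK aA (subvP KA _ xaK).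
  apply: contraNN bK => /mem_add_line[k h]; apply/mem_add_line; exists k.
  apply: AK; first by rewrite memvB ?memvZ.
  by rewrite lieBr lieZr (subvP KA).
apply: double_eq0 => //.
have /(congr1 (fun w => D (D w))) := brk0P hA aA bA.
rewrite !lie0r (lie_der x a) lieDr /= !(lie_der x _ (D b)) (lie_der x _ b).
by rewrite (lieMK aM (D2 _ bA)) (lieKM bM (D2 _ aA)) add0r addr0.
Qed.

Lemma plane_of_cube_zero c : (forall a, a \in A -> D (D (D a)) \in K) ->
  c \in A -> D (D c) \notin K -> exists e f, isotropic_plane e f.
Proof.
move=> D3 cA cK; have cM := subvP AM _ cA.
have [p [q [pA qA def_c]]] := Mdec (xM (xM cM)).
have [pM qM] : p \in M /\ q \in M by rewrite !(subvP AM).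
have pqK : D p + D (D q) \in K by rewrite -lieDr -def_c D3.
(* Otherwise [c] and [p] span [A] modulo [K]; expressing [q] in this basis turns
   [D^3 c \in K] into a relation forcing [p \in K]. *)
have pK : p \in K.
  apply: contraT => npK.
  have ppK : D (D p) \in K.
    have := D4 cM; rewrite def_c !lieDr /= rpredDr //; exact: D3.
  have cpK : c \notin (K + <[p]>)%VS.
    apply: contraNN cK => /mem_add_line[k /xK/xK].
    by rewrite !lieBr /= !lieZr /= rpredBr // memvZ.
  have defA : (K + <[p]> + <[c]>)%VS = A.
    by apply: add_line_eq; rewrite ?add_line_sub // dim_add_line // dA.
  have : q \in (K + <[p]> + <[c]>)%VS by rewrite defA.
  case/mem_add_line=> s /mem_add_line[t qK].
  have {}qK : D (D q) - s *: D (D c) \in K.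
    have := xK (xK qK); rewrite !lieBr /= !lieZr /= rpredBr // memvZ //.
  (* Substitute D^2 q = s D^2 c modulo [K], then D^2 c = p + Dq. *)
  have spK : D (p + s *: q) + s *: p \in K.
    have := memvB pqK qK.
    by rewrite opprB addrACA subrr addr0 lieDr lieZr /= -addrA
        -scalerDr [_ + p]addrC def_c.
  have psK : p + s *: q \in K.
    apply: AK; first by rewrite memvD ?memvZ.
    by rewrite -(rpredDr _ (memvZ s pA)) (subvP KA).
  move: spK; rewrite rpredDl ?xK // => spK.
  have [s0|s0] := eqVneq s 0; first by rewrite s0 scale0r addr0 in psK; case/negP: npK.
  by rewrite -(scalerK s0 p) memvZ in npK.
have qqK : D (D q) \in K by move: pqK; rewrite (rpredDl _ (xK pK)).
have fK : D q \notin K by apply: contraNN cK => h; rewrite def_c memvD.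
have twon : (2 : F) != 0 by move: two; rewrite inE.
(* The factor 2 makes [e, f] the second derivative of [c, q]; moreover Df = -e modulo [K]. *)
exists (D q), (q - 2 *: D c); split; last 2 first.
- exact: in_K2.
- rewrite lieBr lieZr /= def_c scalerDr opprD addrCA memvD //.
    by rewrite in_K2 // memvN memvZ.
  by rewrite memv_addl // memvB ?memvZ ?memv_add_line.
- split=> //; [exact: xM|exact: memvB qM (memvZ _ (xM cM))|].
  apply: contraNN cK => /mem_add_line[k h].
  (* Modulo [K], D(2c + kq) equals [q], so it lies in [A] and [AK] applies. *)
  have h2 : 2 *: c + k *: q \in K.
    apply: AK; first by rewrite memvD ?memvZ.
    rewrite lieDr !lieZr /= -memvN -(rpredDl _ qA) opprD addrA; exact: subvP KA _ h.
  have := xK (xK h2); rewrite !lieDr !lieZr (rpredDr _ (memvZ k qqK)) => h3.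
  by rewrite -(scalerK twon (D (D c))) memvZ.
rewrite lieBr lieZr /= [lie (D q) (D c)]lieC scalerN opprK scaler_nat mulr2n.
(* Modulo central terms [D^2 c] is [D q], so differentiating [lie c q = 0] twice
   gives [lie (D q) q + 2 lie (D c) (D q) = 0]. *)
have /(congr1 (fun w => D (D w))) := brk0P hA cA qA.
rewrite !lie0r (lie_der x c) lieDr /= !(lie_der x _ (D q)) (lie_der x _ q).
by rewrite def_c lieDl (lieKM qM pK) add0r (lieMK cM qqK) addr0 addrA.
Qed.

(** The vector [a] generates a Jordan block filling [M / K], whose last two vectors span the plane.
    A second vector [b] of [A], written on this block, supplies the relation for
    [chain_isotropic]. *)
Lemma plane_of_full_chain a : a \in A -> D (D (D a)) \notin K ->
  exists e f, isotropic_plane e f.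
Proof.
move=> aA; set v1 := D a; set v2 := D v1; set v3 := D v2 => v3K.
have aM := subvP AM _ aA.
have [v1M [v2M v3M]] : v1 \in M /\ v2 \in M /\ v3 \in M by rewrite !xM.
have v4K : D v3 \in K by apply: D4.
have v2K : v2 \notin (K + <[v3]>)%VS.
  apply: contraNN v3K => /mem_add_line[k /xK].
  by rewrite lieBr lieZr (rpredBr _ (memvZ k v4K)).
have v1K : v1 \notin (K + <[v3]> + <[v2]>)%VS.
  apply: contraNN v3K => /mem_add_line[j /mem_add_line[k /xK/xK]].
  by rewrite !(lieBr, lieZr) (rpredBr _ (memvZ k (xK v4K))) (rpredBr _ (memvZ j v4K)).
have v0K : a \notin (K + <[v3]> + <[v2]> + <[v1]>)%VS.
  apply: contraNN v3K => /mem_add_line[i /mem_add_line[j /mem_add_line[k /xK/xK/xK]]].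
  rewrite !(lieBr, lieZr) (rpredBr _ (memvZ k (xK (xK v4K)))).
  by rewrite (rpredBr _ (memvZ j (xK v4K))) (rpredBr _ (memvZ i v4K)).
have defM : (K + <[v3]> + <[v2]> + <[v1]> + <[a]>)%VS = M.
  have KM := subv_trans KA AM.
  by apply: add_line_eq; rewrite ?add_line_sub // !dim_add_line // dM.
have aK : a \notin K by apply: contraNN v3K => aK; rewrite !xK.
have /subvPn[b bA bK] : ~~ (A <= K + <[a]>)%VS.
  by apply: dim_nsub; rewrite dA dim_add_line.
have : b \in (K + <[v3]> + <[v2]> + <[v1]> + <[a]>)%VS by rewrite defM (subvP AM).
case/mem_add_line=> s /mem_add_line[al /mem_add_line[be /mem_add_line[ga h]]].
(* Otherwise D(b - s a) lies in [K], hence so does b - s a by [AK]. *)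
have nz : (al != 0) || (be != 0).
  apply: contraNT bK; rewrite negb_or !negbK => /andP[/eqP al0 /eqP be0].
  move: h; rewrite al0 be0 !scale0r !subr0 => h; apply/mem_add_line; exists s.
  apply: AK; first by rewrite memvB ?memvZ.
  move/xK: h; rewrite lieBr lieZr /= rpredBr ?memvZ // => h; exact: subvP KA _ h.
have R0 : lie a (al *: v1 + be *: v2 + ga *: v3) = 0.
  have := lieMK aM h; rewrite !lieBr /= (brk0P hA aA bA) [lie a (s *: a)]lieZr /= liexx.
  rewrite scaler0 subr0 sub0r -!opprD => /eqP; rewrite oppr_eq0 -!lieDr /= => /eqP.
  by [].
exists v3, v2; split=> //; first by rewrite lieC (chain_isotropic aM v4K nz R0) oppr0.
  exact: in_K2.
by rewrite memv_addl // memv_add_line.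
Qed.

Lemma exists_plane : exists e f, isotropic_plane e f.
Proof.
have [h|/existsNP[a /not_implyP[aA /negP]]] :=
    pselect (forall a, a \in A -> D (D (D a)) \in K); last exact: plane_of_full_chain.
have [|/existsNP[c /not_implyP[cA /negP]]] :=
    pselect (forall a, a \in A -> D (D a) \in K); first exact: plane_of_square_zero.
exact: plane_of_cube_zero.
Qed.

End Derivation.

(** * Abelian ideals of codimension three *)

Lemma stable_plane x M K e f : brk M K 0%VS -> (K <= M)%VS ->
    (forall k, k \in K -> lie x k \in K) -> isotropic_plane x M K e f ->
    brk M <[e]>%VS K -> brk M <[f]>%VS K -> (M + <[x]>)%VS = fullv ->
  exists E, [/\ brk fullv E E, brk E E 0%VS & \dim E = (\dim K).+2].
Proof.
move=> KC KM xK [[eM fM eK fK] ef xe xf] hMe hMf defL.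
pose B := (K + <[e]> + <[f]>)%VS.
have KB : (K <= B)%VS by rewrite /B -addvA addvSl.
have BM : (B <= M)%VS by rewrite !add_line_sub.
have KB0 : brk K B 0%VS by apply/brkC; apply: brkS KC; rewrite ?subvv.
exists B; split; last by rewrite !dim_add_line.
- rewrite -defL; apply: brkDl.
    apply: (brkS (subvv M) (subvv B) KB).
    by apply: (brkDr _ hMf); apply: (brkDr _ hMe); apply: brk0W.
  apply: brkDr; last by apply: brk_lines.
  by apply: brkDr; [apply: brk_linel => k /xK /(subvP KB)|apply: brk_lines].
have hlines : brk (<[e]> + <[f]>)%VS (<[e]> + <[f]>)%VS 0%VS.
  by apply: brkDl; apply: brkDr; try exact: brk_self; apply: brk_lines;
     rewrite ?[lie f e]lieC ef ?oppr0 mem0v.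
have defB : B = (K + (<[e]> + <[f]>))%VS by rewrite addvA.
rewrite {1}defB; apply: (brkDl KB0); rewrite defB; apply: (brkDr _ hlines).
by apply/brkC; apply: brkS KB0; rewrite ?subvv // defB addvSr.
Qed.

Lemma ideal_abelian_codim3 A M : lie_nilpotent L -> 2%N \notin [pchar F] ->
    brk A A 0%VS -> (A <= M)%VS -> brk fullv M M -> brk M A A ->
    \dim M = (\dim A).+2 -> \dim {:L} = (\dim M).+1 ->
  exists E, [/\ brk fullv E E, brk E E 0%VS & \dim E = \dim A].
Proof.
move=> nil two hA AM hM hMA dM dL.
have /subvPn[x _ xnM] : ~~ (fullv <= M)%VS by apply: dim_nsub; rewrite dL.
have defL : (M + <[x]>)%VS = fullv by apply: add_line_eq; rewrite ?subvf ?memvf ?dL.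
have hMM : brk M M M by apply: brkS hM; rewrite ?subvv ?subvf.
have xM v : v \in M -> lie x v \in M by apply: hM (memvf x).
have inM v : v \in A -> v \in M by apply: (subvP AM).
have fromK B K : brk fullv B B -> (K <= B)%VS -> brk B K 0%VS ->
    (\dim A <= (\dim K).+1)%N -> (\dim A <= \dim B)%N ->
  exists E, [/\ brk fullv E E, brk E E 0%VS & \dim E = \dim A].
  move=> hB KB BK0 dK dB.
  by have [E [_ ? ? ?]] := stable_abelian nil hB KB BK0 dK dB; exists E.
have dAM : (\dim A <= \dim M)%N by exact: dimvS.
pose K := preim A x A; have KA : (K <= A)%VS := preim_subl _ _ _.
have KM := subv_trans KA AM.
pose Z := center M; have ZM : (Z <= M)%VS := center_sub M.
have hZ : brk fullv Z Z := center_stable hM.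
have xZ v : v \in Z -> lie x v \in Z by apply: hZ (memvf x).
have MZ0 : brk M Z 0%VS by apply: brk_center.
(* Four applications suffice because [Z] then has codimension four in [M]. *)
have D4 v : v \in M -> (\dim Z).+2 = \dim A -> lie x (lie x (lie x (lie x v))) \in Z.
  move=> vM dZ; apply: (iter_lie_mem (r := 4) nil hM hZ ZM _ (memvf x) vM).
  by rewrite dM -dZ addnC.
have [AK|/subvPn[a aA aK]] := boolP (A <= K)%VS.
  exists A; split=> //; rewrite -defL; apply: brkDl => //.
  by apply: brk_linel => c /(subvP AK); rewrite mem_preim => /andP[].
have xaA : lie x a \notin A by move: aK; rewrite mem_preim aA.
have xaM := xM _ (inM _ aA).
pose N := (A + <[lie x a]>)%VS; have AN : (A <= N)%VS := addvSl _ _.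
have dN : \dim N = (\dim A).+1 by rewrite dim_add_line.
have NM : (N <= M)%VS by rewrite add_line_sub.
have NK0 : brk N K 0%VS.
  apply: brkDl; first by apply: brkS hA; rewrite ?subvv.
  by apply: brk_linel => c cK; rewrite (brk_preim hA) ?mem0v.
(* If [M = A + lie x A] then [K] is central in [M], and [lie x] has no nonzero
   invariant subspace in [A / K], which forces [[M, M]] into [K]. *)
have [xAN|/subvPn[b bA bN]] := boolP (A <= preim A x N)%VS; last first.
  have xbN : lie x b \notin N by move: bN; rewrite mem_preim bA.
  have xbM := xM _ (inM _ bA).
  have defM : (N + <[lie x b]>)%VS = M by apply: add_line_eq; rewrite ?dN ?dM.
  have MK0 : brk M K 0%VS.
    rewrite -defM; apply: brkDl => //.
    by apply: brk_linel => c cK; rewrite (brk_preim hA) ?mem0v.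
  have Mdec v : v \in M -> exists i j, v - j *: lie x b - i *: lie x a \in A.
    by rewrite -{1}defM => /mem_add_line[j /mem_add_line[i h]]; exists i, j.
  have AKab : (A <= K + <[a]> + <[b]>)%VS.
    apply/subvP=> c cA; have [i [j h]] := Mdec _ (xM _ (inM _ cA)).
    apply/mem_add_line; exists j; apply/mem_add_line; exists i.
    by rewrite mem_preim !memvB ?memvZ //= !(lieBr, lieZr).
  have dAK : (\dim A <= (\dim K).+2)%N.
    apply: leq_trans (dimvS AKab) (leq_trans (dim_add_line_le _ _) _).
    exact: dim_add_line_le.
  have KZ : (K <= Z)%VS by apply: center_max.
  have [dZ|dZ] := leqP (\dim A) (\dim Z).+1; first exact: fromK MZ0 dZ dAM.
  have dKZ := dimvS KZ.
  have defZ : K = Z by apply: subv_dim => //; apply: leq_trans dZ dAK.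
  have dA : \dim A = (\dim K).+2 by apply/eqP; rewrite eqn_leq dAK /= defZ.
  (* [M / A] is nilpotent of dimension two, hence abelian. *)
  have hMMA : brk M M A.
    have [|v [vM vA Mv]] := @lie_step M M A nil hMM.
      by apply: dim_nsub; rewrite dM.
    have /subvPn[w wM wN] : ~~ (M <= A + <[v]>)%VS.
      by apply: dim_nsub; rewrite dim_add_line // dM.
    have defM' : (A + <[v]> + <[w]>)%VS = M.
      by apply: add_line_eq; rewrite ?add_line_sub // dim_add_line // dM.
    have hMAv : brk M (A + <[v]>)%VS A by apply: (brkDr hMA); apply: brk_line.
    rewrite -[X in brk _ X]defM'; apply: brkDr => //; apply/brkC; rewrite -defM'.
    apply: brkDr; last exact/brk0W/brk_self.
    by apply: brkS hMAv; rewrite ?subvv -?memvE.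
  (* [lie x] sends brackets of [M] to sums of such brackets, which stay in [A]. *)
  have hMMK : brk M M K.
    move=> u w uM wM; rewrite mem_preim hMMA //= lie_der.
    by apply: memvD; apply: hMMA => //; apply: xM.
  have xK k : k \in K -> lie x k \in K by rewrite defZ; apply: xZ.
  have [|||||e [f ef]] := @exists_plane x M K two MK0 xM xK A hA AM KA.
  - by move=> u uA xuA; rewrite mem_preim uA.
  - move=> v /Mdec[i [j h]].
    exists (v - j *: lie x b - i *: lie x a), (i *: a + j *: b).
    split=> //; first by rewrite memvD ?memvZ.
    by rewrite lieDr !lieZr addrA !subrK.
  - by move=> v vM; rewrite defZ; apply: D4 => //; rewrite -defZ.
  - exact: dA.
  - by rewrite dM dA.
  have [[eM fM _ _] _ _ _] := ef.
  rewrite dA; apply: stable_plane ef _ _ defL => //; apply: brk_line => u uM;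
    exact: hMMK.
have xN c : c \in A -> lie x c \in N.
  by move/(subvP xAN); rewrite mem_preim => /andP[].
have dAK : (\dim A <= (\dim K).+1)%N.
  by apply: leq_trans (dim_add_line_le K a); apply/dimvS/preim_add_line.
(* [u, [x, a]] = [[u, x], a] + [x, [u, a]], with [u, x] in [M] and [u, a] in [A]. *)
have hMN : brk M N N.
  apply: brkDr; first by apply: brkS hMA; rewrite ?subvv.
  apply: brk_line => u uM; rewrite lie_der memvD ?xN ?hMA //.
  rewrite (subvP AN) // hMA // lieC memvN xM //.
(* In the first case [N] is an ideal of [L] in which [K] is central. *)
have [xxaN|xxaN] := boolP (lie x (lie x a) \in N).
  apply: (fromK N K) => //; rewrite ?dN // ?(subv_trans KA AN) //.
  rewrite -defL; apply: brkDl => //; apply: brkDr; last exact: brk_lines.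
  by apply: brk_linel.
have xxaM := xM _ xaM.
have defM : (N + <[lie x (lie x a)]>)%VS = M by apply: add_line_eq; rewrite ?dN ?dM.
(* Differentiating [[x, a], c] = 0 shows that [x, [x, a]], which completes [N] to [M], also commutes
   with [c]. *)
have xxaK c : c \in K -> lie x c \in K -> forall u, u \in M -> lie u c = 0.
  move=> cK xcK u; have xaN : lie x a \in N by apply: memv_add_line.
  have ec : lie (lie x (lie x a)) c = 0.
    have := lie_der x (lie x a) c; rewrite (brk0P NK0 xaN cK) (brk0P NK0 xaN xcK).
    by rewrite lie0r addr0.
  rewrite -{1}defM => /mem_add_line[k h]; have := brk0P NK0 h cK.
  rewrite lieC lieBr lieZr [lie c (lie x _)]lieC ec oppr0 scaler0 subr0 => <-.
  exact: lieC.
have [xKK|/subvPn[v0 v0K v0n]] := boolP (K <= preim K x K)%VS.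
  apply: (fromK M K) => // u c uM cK; rewrite memv0 xxaK //.
  by move/(subvP xKK): cK; rewrite mem_preim => /andP[].
(* The remaining case: [lie x] acts on [M / Z] as a single Jordan block
   [v0, v1, v2, v3], with [v0] and [v1] in [A]. *)
have {v0n} v1K : lie x v0 \notin K by move: v0n; rewrite mem_preim v0K.
set v1 := lie x v0 in v1K; set v2 := lie x v1; set v3 := lie x v2.
have v0A := subvP KA _ v0K.
have v1A : v1 \in A by move: v0K; rewrite mem_preim => /andP[].
have v2A : v2 \notin A by move: v1K; rewrite mem_preim v1A.
have [v0M v1M] := (inM _ v0A, inM _ v1A); have v2M : v2 \in M := xM _ v1M.
have v3M : v3 \in M := xM _ v2M.
have defA : (K + <[v1]>)%VS = A by apply: add_line_eq.
have defN : (A + <[v2]>)%VS = N.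
  by apply: add_line_eq => //; rewrite ?dN // xN.
have v3N : v3 \notin N.
  apply: contraNN xxaN => v3N; have : lie x a \in N by apply: memv_add_line.
  rewrite -{1}defN => /mem_add_line[k /xN]; rewrite lieBr lieZr -/v3.
  by rewrite (rpredBr _ (memvZ k v3N)).
have defM3 : (N + <[v3]>)%VS = M by apply: add_line_eq; rewrite ?dN ?dM.
(* By [xxaK] this subspace is central in [M]; its codimension in [K] is at most one since [lie x]
   maps [K] into [K + <[v1]>]. *)
pose K2 := preim K x K.
have K2Z : (K2 <= Z)%VS.
  apply/subvP=> c; rewrite mem_preim => /andP[cK xcK]; apply/mem_center.
  by split; [apply: (subvP KM)|apply: xxaK].
have K2v0 : (K <= K2 + <[v0]>)%VS.
  by apply: preim_add_line => // c; rewrite defA mem_preim => /andP[].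
have dKK2 : (\dim K <= (\dim K2).+1)%N.
  by apply: leq_trans (dimvS K2v0) (dim_add_line_le _ _).
have [dZ|dZ] := leqP (\dim A) (\dim Z).+1; first exact: (fromK M Z).
have dAK2 : (\dim A <= (\dim K2).+2)%N by apply: leq_trans dAK _; rewrite ltnS.
have defZ : K2 = Z by apply: subv_dim => //; apply: leq_trans dZ dAK2.
have dA : (\dim Z).+2 = \dim A.
  by apply/eqP; rewrite eqn_leq dZ -defZ dAK2.
have v4Z : lie x v3 \in Z by apply: D4.
have e01 : lie v0 v1 = 0 by apply: (brk0P hA).
have [e02 e12 e13 e23] := chain_abelian two MZ0 xM v0M v4Z e01.
rewrite -/v1 -/v2 -/v3 in e02 e12 e13 e23.
(* This bracket lies in [A] and is killed by [lie x], so it is in [K] and then in [K2]. *)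
have zZ : lie v1 v2 \in Z.
  have xz : lie x (lie v1 v2) = 0 by rewrite lie_der -/v2 liexx -/v3 e13 addr0.
  have zA : lie v1 v2 \in A by rewrite lieC memvN hMA.
  by rewrite -defZ mem_preim xz mem0v andbT mem_preim xz mem0v andbT.
have ZA : (Z <= A)%VS by rewrite -defZ (subv_trans (preim_subl _ _ _)).
(* The plane is the end of the block: its only possibly nonzero brackets with [v0], ..., [v3] are,
   up to sign, [v1, v2] and [v0, v3], both in [Z]. *)
rewrite -dA; apply: (@stable_plane x M Z v2 v3) => //.
- split.
  + split=> //; first by apply: contraNN v2A; apply: subvP.
    apply: contraNN v3N; rewrite -defN; apply: subvP.
    by rewrite add_line_sub ?memv_add_line // (subv_trans ZA) ?addvSl.
  + exact: e23.
  + exact: memv_add_line.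
  + by rewrite !memv_addl.
- rewrite -defM3; apply: brkDl; last by apply: brk_lines; rewrite lieC e23 oppr0 mem0v.
  rewrite -defN; apply: brkDl; last exact/brk0W/brk_self.
  rewrite -defA; apply: brkDl; last exact: brk_lines.
  have v2N : v2 \in N by apply: xN.
  by apply: brk0W; apply/brkC; apply: brkS NK0; rewrite ?subvv -?memvE.
- rewrite -defM3; apply: brkDl; last exact/brk0W/brk_self.
  rewrite -defN; apply: brkDl; last by apply: brk_lines; rewrite e23 mem0v.
  rewrite -defA; apply: brkDl; last by apply: brk_lines; rewrite e13 mem0v.
  apply: (brkS K2v0 (subvv _) (subvv _)); rewrite defZ; apply: brkDl.
    by apply/brk0W/brkC; apply: brkS MZ0; rewrite ?subvv -?memvE.
  by apply: brk_lines; rewrite -[lie v0 v3]opprK -e12 memvN.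
Qed.

End Brackets.

(** * Equality of the two invariants *)

Theorem theorem4p1 (F : fieldType) (L : lieAlgType F) (n : nat)
    (char_neq2 : 2%N \notin [pchar F])
    (dimL : \dim {:L} = n)
    (nilL : lie_nilpotent L)
    (alphaL : (lie_alpha L)%:Z = n%:Z - 3) :
  (lie_beta L)%:Z = n%:Z - 3.
Proof.
have {alphaL} dn : n = (lie_alpha L).+3 by lia.
suff -> : lie_beta L = lie_alpha L by lia.
(* The zero subspace makes both families nonempty, so the maxima are attained. *)
have ab0 : exists A : {vspace L}, lie_subalgebra A /\ lie_abelian A.
  exists 0%VS; split=> u v; rewrite memv0 => /eqP -> _; rewrite lie0l ?mem0v //.
have ib0 : exists A : {vspace L}, lie_ideal A /\ lie_abelian A.
  exists 0%VS; split=> u v; rewrite memv0 => /eqP ->; rewrite lie0l ?mem0v //.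
apply/eqP; rewrite eqn_leq; apply/andP; split.
  have [B [iB aB] dB] := max_dim_attained ib0; rewrite /lie_beta -dB.
  by apply: max_dim_le; split=> // u v uB _; apply: iB.
have [A [sA aA] dA] := max_dim_attained ab0; rewrite -/(lie_alpha L) in dA.
have hA : brk A A 0%VS by move=> u v uA vA; rewrite aA ?mem0v.
have dL : \dim {:L} = (\dim A).+3 by rewrite dA dimL dn.
have hL : brk (fullv : {vspace L}) fullv fullv by move=> *; apply: memvf.
have h0 : brk A A A by apply: brk0W.
have [|N [AN _ hN _ dN]] := subalgebra_step nilL h0 (subvf _) hL.
  by rewrite dL ltnS -addn2 leq_addr.
have [|M [NM _ hMM _ dM']] := subalgebra_step nilL hN (subvf _) hL.
  by rewrite dL dN.
(* The third normalizer step reaches [L], so the hyperplane [M] is an ideal. *)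
have [|M' [_ _ _ hM dM'']] := subalgebra_step nilL hMM (subvf _) hL.
  by rewrite dL dM' dN.
have dM : \dim M = (\dim A).+2 by rewrite dM' dN.
have AM := subv_trans AN NM.
have {}hM : brk fullv M M.
  by rewrite -(subv_dim (subvf M')) // dL dM'' dM.
have [A' [A'M hMA' hA' dA']] := stable_abelian_codim2 nilL hA AM hMM dM.
have [||B [hB aB dB]] := ideal_abelian_codim3 nilL char_neq2 hA' A'M hM hMA'.
- by rewrite dM dA'.
- by rewrite dL dM.
rewrite -dA -dA' -dB; apply: max_dim_le; split=> u v uB => [|vB].
  by rewrite lieC memvN hB ?memvf.
exact: brk0P aB uB vB.
Qed.
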